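(* Let $\mathcal{H}=(V,E)$ be a hypergraph with rank $r$, $|E|=m$, $|V|=n$ and maximum degree $\Delta$. Then $$\mathcal{E}(\mathcal{H})\le \sqrt{n(r-1)Z(\mathcal{H})}\le \sqrt{nm(r^2-r)\Delta}.$$ Equality holds if and only if $\mathcal{H}$ is a $2$-uniform hypergraph whose edges are pairwise disjoint and which has no isolated vertices, or $\mathcal{H}$ has no edges.
   Context: A hypergraph $\mathcal{H}=(V,E)$ consists of a finite vertex set $V$ and a set $E$ of edges, each edge being a subset of $V$ of cardinality at least $2$ (distinct edges are distinct subsets). It is $k$-uniform if every edge has exactly $k$ vertices. The rank of $\mathcal{H}$ is the largest cardinality of an edge (for an edgeless hypergraph all quantities in the bounds are $0$). For $\alpha\subseteq V$, $d(\alpha)$ is the number of edges containing all vertices of $\alpha$; the degree of $v$ is $d(v)=d(\{v\})$, and $\Delta=\max_v d(v)$. A vertex is isolated if it lies in no edge. The Zagreb index is $Z(\mathcal{H})=\sum_{v\in V}d(v)^2$. The adjacency matrix $\mathbf{A}(\mathcal{H})$ is the $n\times n$ matrix with zero diagonal and $(i,j)$ entry $d(\{i,j\})$ for $i\neq j$. The energy is $\mathcal{E}(\mathcal{H})=\sum_{i=1}^n|\lambda_i|$, where $\lambda_1\ge\dots\ge\lambda_n$ are the eigenvalues of $\mathbf{A}(\mathcal{H})$. *)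

(* Defs.v *)
From HB Require Import structures.
From mathcomp Require Import all_boot all_order all_algebra.
From mathcomp Require Import complex.

Set Implicit Arguments.
Unset Strict Implicit.
Unset Printing Implicit Defensive.

Import Order.TTheory GRing.Theory Num.Theory.
Local Open Scope ring_scope.

Record hypergraph (V : finType) := Hypergraph {
  edges : {set {set V}};
  edges_card_ge2 : forall e : {set V}, e \in edges -> (1 < #|e|)%N
}.

Section HypergraphNotions.
Variables (V : finType) (H : hypergraph V).

Definition codegree (alpha : {set V}) : nat :=
  #|[set e in edges H | alpha \subset e]|.

Definition degree (v : V) : nat := codegree [set v].

Definition max_degree : nat := \max_(v : V) degree v.

(* The value is 0 when there is no edge. *)
Definition rank : nat := \max_(e in edges H) #|e|.

Definition isolated (v : V) : Prop :=
  forall e : {set V}, e \in edges H -> v \notin e.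

Definition uniform (k : nat) : Prop :=
  forall e : {set V}, e \in edges H -> #|e| = k.

Definition zagreb : nat := (\sum_(v : V) degree v ^ 2)%N.

(* Rows and columns are indexed through the enumeration of V. *)
Definition adjmx (R : pzRingType) : 'M[R]_#|V| :=
  \matrix_(i, j) if i == j then 0
                 else (codegree [set enum_val i; enum_val j])%:R.

End HypergraphNotions.

(* Having all eigenvalues in R, with multiplicities given by the
   characteristic polynomial, sorted in non-increasing order. *)
Definition is_spectrum (R : rcfType) (n : nat) (A : 'M[R]_n)
    (lam : n.-tuple R) : bool :=
  sorted >=%R lam && (char_poly A == \prod_(x <- lam) ('X - x%:P)).

Lemma symmetric_spectrum_exists (R : rcfType) (n : nat) (A : 'M[R]_n) :
  A^T = A -> exists lam : n.-tuple R, is_spectrum A lam.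
Proof.
move=> symA.
pose toC := real_complex R; pose B : 'M[R[i]]_n := map_mx toC A.
have Bherm : B \is hermsymmx.
  apply: realsym_hermsym.
    apply/is_hermitianmxP; rewrite expr0 scale1r map_mx_id //.
    by apply/matrixP => i j; rewrite !mxE -{1}symA mxE.
  by apply/mxOverP => i j; rewrite mxE complex_real.
have /mxOverP dreal := hermitian_spectral_diag_real Bherm.
have /orthomx_spectralP defB := hermitian_normalmx Bherm.
set P := spectralmx B in defB; set d := spectral_diag B in defB dreal.
have Pu : P \in unitmx by apply: spectral_unit.
have charB : char_poly B = char_poly (diag_mx d).
  pose Q := map_mx (@polyC R[i]) P.
  have Qu : map_mx (@polyC R[i]) (invmx P) *m Q = 1%:M.
    by rewrite -map_mxM mulVmx // map_mx1.
  have -> : char_poly B =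
      \det (map_mx (@polyC R[i]) (invmx P) *m char_poly_mx (diag_mx d) *m Q).
    congr (\det _); rewrite /char_poly_mx mulmxBr mulmxBl.
    by rewrite scalar_mxC -(mulmxA 'X%:M) Qu mulmx1 -!map_mxM -defB.
  by rewrite !det_mulmx mulrAC -det_mulmx Qu det1 mul1r.
pose s := sort >=%R [seq complex.Re (d 0 i) | i <- enum 'I_n].
have s_size : size s == n by rewrite size_sort size_map size_enum_ord.
exists (Tuple s_size); apply/andP; split=> /=.
  by apply: sort_sorted => x y; rewrite ge_total.
apply/eqP; apply: (map_poly_inj toC).
rewrite map_char_poly -/B charB char_poly_trig ?diag_mx_is_trig //.
rewrite (perm_big [seq complex.Re (d 0 i) | i <- enum 'I_n]) /=; last first.
  by rewrite perm_sort.
rewrite big_map big_enum /= rmorph_prod /=; apply: eq_bigr => i _.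
rewrite mxE eqxx mulr1n rmorphB /= map_polyX map_polyC /=.
by rewrite RRe_real.
Qed.

Lemma adjmx_sym (V : finType) (H : hypergraph V) (R : pzRingType) :
  (adjmx H R)^T = adjmx H R.
Proof. by apply/matrixP => i j; rewrite !mxE eq_sym setUC. Qed.

Section Energy.
Variables (V : finType) (H : hypergraph V) (R : rcfType).

(* is_spectrum determines the tuple, so the choice made here is immaterial. *)
Definition eigenvalues : #|V|.-tuple R :=
  xchoose (symmetric_spectrum_exists (adjmx_sym H R)).

Lemma eigenvaluesP : is_spectrum (adjmx H R) eigenvalues.
Proof. exact: xchooseP. Qed.

Definition energy : R := \sum_(i < #|V|) `|tnth eigenvalues i|.

End Energy.

(* Main.v *)
(* Cauchy-Schwarz gives E^2 <= n tr(A^2), and tr(A^2) is the sum over u of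
   sum_{v <> u} d(u,v)^2 <= d(u) sum_{v <> u} d(u,v)
                         = d(u) sum_{e containing u} (|e| - 1) <= (r-1) d(u)^2;
   the second bound follows from d(v) <= Delta and sum_v d(v) = sum_e |e| <= m r.
   Equality in the first bound forces all |lambda_i| to coincide, hence
   A^2 = c I because A is diagonalizable.  As soon as there is an edge, c <> 0,
   and A^2 = c I then says that every vertex has exactly one neighbour, so that
   the edges form a perfect matching.  Conversely A^2 = I for a perfect matching,
   so E = n, which is also the value of the second bound. *)

Require Import Defs.
From mathcomp Require Import all_boot all_order all_algebra complex ring.
Import Order.TTheory GRing.Theory Num.Theory.
Local Open Scope ring_scope.

Set Implicit Arguments.
Unset Strict Implicit.
Unset Printing Implicit Defensive.

(** * Spectra of symmetric matrices and a sharp form of Cauchy-Schwarz *)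

Lemma char_poly_conj (R : comUnitRingType) (n : nat) (P A : 'M[R]_n) :
  P \in unitmx -> char_poly (invmx P *m A *m P) = char_poly A.
Proof.
move=> Pu; pose Q := map_mx (@polyC R) P; pose Q' := map_mx (@polyC R) (invmx P).
have Q'Q : Q' *m Q = 1%:M by rewrite -map_mxM mulVmx // map_mx1.
(* The scalar matrix of ['X] commutes with the constant matrix [Q'], so the conjugation passes
   through the characteristic matrix. *)
have -> : char_poly (invmx P *m A *m P) = \det (Q' *m char_poly_mx A *m Q).
  congr (\det _); rewrite /char_poly_mx mulmxBr mulmxBl.
  by rewrite scalar_mxC -(mulmxA 'X%:M) Q'Q mulmx1 -!map_mxM.
by rewrite !det_mulmx mulrAC -det_mulmx Q'Q det1 mul1r.
Qed.

Section SymmetricSpectrum.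
Variables (R : rcfType) (n : nat) (A : 'M[R]_n) (lam : n.-tuple R).
Hypotheses (symA : A^T = A) (lamP : is_spectrum A lam).

(** Over [R[i]] the matrix is Hermitian, so the spectral theorem applies. The diagonal and [lam]
    both factor the same characteristic polynomial into monic linear factors, hence they agree up to
    order. *)
Lemma symmetric_diagonalization :
  exists (P : 'M[R[i]]_n) (d : 'rV[R[i]]_n),
    [/\ P \in unitmx,
        map_mx (real_complex R) A = invmx P *m diag_mx d *m P
      & perm_eq [seq d 0 i | i <- enum 'I_n]
                [seq real_complex R x | x <- lam]].
Proof.
have /andP[_ /eqP charA] := lamP.
set B := map_mx (real_complex R) A.
have Bherm : B \is hermsymmx.
  apply: realsym_hermsym; last by apply/mxOverP => i j; rewrite mxE complex_real.
  apply/is_hermitianmxP; rewrite expr0 scale1r map_mx_id // /B.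
  by rewrite -{1}symA map_trmx.
have /orthomx_spectralP defB := hermitian_normalmx Bherm.
have Pu : spectralmx B \in unitmx by apply: spectral_unit.
exists (spectralmx B), (spectral_diag B); split=> //; apply: prod_XsubC_eq.
transitivity (char_poly B).
  rewrite defB char_poly_conj // -defB char_poly_trig ?diag_mx_is_trig //.
  by rewrite big_map big_enum; apply: eq_bigr => i _; rewrite mxE eqxx mulr1n.
rewrite -map_char_poly charA rmorph_prod big_map; apply: eq_bigr => x _.
by rewrite rmorphB /= map_polyX map_polyC.
Qed.

Lemma sqr_conj_diag (P : 'M[R[i]]_n) (d : 'rV[R[i]]_n) : P \in unitmx ->
  map_mx (real_complex R) A = invmx P *m diag_mx d *m P ->
  map_mx (real_complex R) (A *m A)
    = invmx P *m diag_mx (\row_j d 0 j ^+ 2) *m P.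
Proof.
move=> Pu defA; have -> : \row_j d 0 j ^+ 2 = \row_j (d 0 j * d 0 j).
  by apply/rowP => j; rewrite !mxE expr2.
by rewrite map_mxM defA -mulmx_diag !mulmxA mulmxK.
Qed.

Lemma sum_sqr_spectrum : \sum_(x <- lam) x ^+ 2 = \tr (A *m A).
Proof.
have [P [d [Pu defA d_lam]]] := symmetric_diagonalization.
apply: (fmorph_inj (real_complex R)); rewrite -trace_map_mx (sqr_conj_diag Pu defA).
rewrite mxtrace_mulC mulmxA mulmxV // mul1mx mxtrace_diag rmorph_sum.
under eq_bigr do rewrite rmorphXn.
rewrite -(big_map (real_complex R) xpredT (fun y => y ^+ 2)) -(perm_big _ d_lam).
by rewrite big_map big_enum; apply: eq_bigr => i _; rewrite mxE.
Qed.

Lemma sqr_spectrum_const (c : R) :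
  (forall x, x \in lam -> x ^+ 2 = c) -> A *m A = c%:M.
Proof.
have [P [d [Pu defA d_lam]]] := symmetric_diagonalization => lam_c.
apply: (@map_mx_inj _ _ (real_complex R)); rewrite (sqr_conj_diag Pu defA).
have -> : diag_mx (\row_j d 0 j ^+ 2) = (real_complex R c)%:M.
  rewrite -diag_const_mx; congr diag_mx; apply/rowP => j; rewrite !mxE.
  have : d 0 j \in [seq real_complex R x | x <- lam].
    by rewrite -(perm_mem d_lam) map_f // mem_enum.
  by case/mapP => x /lam_c <- ->; rewrite rmorphXn.
by rewrite -mulmxA mul_scalar_mx -scalemxAr mulVmx // scalemx1 map_scalar_mx.
Qed.

Lemma spectrum_eigenvalue (x : R) : x \in lam -> eigenvalue A x.
Proof.
have /andP[_ /eqP charA] := lamP.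
by rewrite eigenvalue_root_char charA root_prod_XsubC.
Qed.

End SymmetricSpectrum.

Lemma eigenvalue_sqr_scalar (F : fieldType) (n : nat) (A : 'M[F]_n) (c x : F) :
  A *m A = c%:M -> eigenvalue A x -> x ^+ 2 = c.
Proof.
move=> AA /eigenvalueP[v vA v_neq0]; apply/eqP; rewrite -subr_eq0.
have : (x ^+ 2 - c) *: v == 0.
  rewrite scalerBl expr2 -scalerA -vA scalemxAl -vA -mulmxA AA mul_mx_scalar.
  by rewrite subrr.
by rewrite scaler_eq0 (negPf v_neq0) orbF.
Qed.

(** The variance identity, scaled by [#|I|] to avoid division. A sum of squares being nonnegative
    yields Cauchy-Schwarz, and its vanishing describes the equality case. *)
Lemma sum_sqr_dev (R : comPzRingType) (I : finType) (f : I -> R) :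
  \sum_i (#|I|%:R * f i - \sum_j f j) ^+ 2
    = #|I|%:R * (#|I|%:R * (\sum_i f i ^+ 2) - (\sum_i f i) ^+ 2).
Proof.
set s := \sum_i f i; set q := \sum_i f i ^+ 2; set n := #|I|%:R.
transitivity (\sum_i (n ^+ 2 * f i ^+ 2 - n * s *+ 2 * f i + s ^+ 2)).
  by apply: eq_bigr => i _; ring.
rewrite big_split sumrB /= -!mulr_sumr -/s -/q sumr_const -mulr_natl -/n.
by ring.
Qed.

(** * Counting bounds on degrees and codegrees *)

Section CodegreeBounds.
Variables (V : finType) (H : hypergraph V).

Lemma codegreeE (alpha : {set V}) :
  codegree H alpha = (\sum_(e in edges H) (alpha \subset e))%N.
Proof.
rewrite -big_mkcondr sum1_card; apply: eq_card => e.
by rewrite !inE.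
Qed.

Lemma codegreeS (alpha beta : {set V}) :
  alpha \subset beta -> (codegree H beta <= codegree H alpha)%N.
Proof.
move=> sub; apply/subset_leq_card/subsetP => e; rewrite !inE => /andP[-> /=].
exact: subset_trans.
Qed.

Lemma rank_max (e : {set V}) : e \in edges H -> (#|e| <= rank H)%N.
Proof. by move=> eH; rewrite /rank (bigD1 e) //= leq_maxl. Qed.

Lemma sum_degree : (\sum_v degree H v = \sum_(e in edges H) #|e|)%N.
Proof.
under eq_bigr do rewrite /degree codegreeE.
rewrite exchange_big; apply: eq_bigr => e _.
by rewrite -sum1_card -big_mkcond; apply: eq_bigl => v; rewrite sub1set.
Qed.

(** Double counting of the pairs (v, e) with v different from u and both vertices in e. *)
Lemma sum_codegree2 (u : V) :
  (\sum_(v | v != u) codegree H [set u; v]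
    = \sum_(e in edges H | u \in e) #|e|.-1)%N.
Proof.
under eq_bigr do rewrite codegreeE.
rewrite exchange_big big_mkcondr; apply: eq_bigr => e _ /=.
case: ifP => ue; last first.
  by rewrite big1 // => v _; rewrite subUset sub1set ue.
rewrite (cardsD1 u) ue /= -sum1_card -big_mkcondr; apply: eq_bigl => v.
by rewrite subUset !sub1set ue !inE.
Qed.

Lemma sum_codegree2_le (u : V) :
  (\sum_(v | v != u) codegree H [set u; v] <= (rank H).-1 * degree H u)%N.
Proof.
rewrite sum_codegree2 /degree codegreeE big_distrr [leqLHS]big_mkcondr /=.
apply: leq_sum => e eH; rewrite sub1set; case: (u \in e) => //.
by rewrite muln1 -!subn1 leq_sub2r ?rank_max.
Qed.

Lemma sum_codegree2_sqr_le (u : V) :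
  (\sum_(v | v != u) codegree H [set u; v] ^ 2
    <= (rank H).-1 * degree H u ^ 2)%N.
Proof.
apply: (@leq_trans (degree H u * \sum_(v | v != u) codegree H [set u; v])).
  rewrite big_distrr; apply: leq_sum => v _; rewrite -mulnn leq_mul2r.
  by rewrite codegreeS ?orbT ?subsetUl.
by rewrite mulnC -mulnn mulnA leq_mul2r sum_codegree2_le orbT.
Qed.

Lemma zagreb_le : (zagreb H <= #|edges H| * rank H * max_degree H)%N.
Proof.
apply: (@leq_trans (\sum_v degree H v * max_degree H)).
  apply: leq_sum => v _; rewrite -mulnn leq_mul2l.
  by rewrite /max_degree (bigD1 v) //= leq_maxl orbT.
rewrite -big_distrl /= leq_mul2r sum_degree -sum_nat_const.
by apply/orP; right; apply: leq_sum => e; apply: rank_max.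
Qed.

Lemma codegree2_gt0 (u v : V) :
  reflect (exists e, [/\ e \in edges H, u \in e & v \in e])
    (0 < codegree H [set u; v])%N.
Proof.
apply: (iffP card_gt0P) => [[e] | [e [eH ue ve]]]; last first.
  by exists e; rewrite inE eH subUset !sub1set ue.
by rewrite inE subUset !sub1set => /and3P[eH ue ve]; exists e.
Qed.

(** * Entries of the squared adjacency matrix *)

Section Adjacency.
Variable R : rcfType.
Local Notation A := (adjmx H R).

Lemma adjmx_sqrE (u v : V) : (A *m A) (enum_rank u) (enum_rank v)
  = (\sum_(w | (w != u) && (w != v))
      codegree H [set u; w] * codegree H [set w; v])%:R.
Proof.
rewrite mxE natr_sum [RHS]big_mkcond.
rewrite (reindex (enum_val : 'I_#|V| -> V)) /=; last first.
  exact/onW_bij/enum_val_bij.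
apply: eq_bigr => i _; rewrite !mxE !enum_rankK.
rewrite -(can_eq enum_valK) -(can_eq enum_valK i) !enum_rankK.
rewrite [u == _]eq_sym.
by case: eqP => _; rewrite ?mul0r //; case: eqP => _; rewrite ?mulr0 // natrM.
Qed.

Lemma tr_adjmx_sqr : \tr (A *m A)
  = (\sum_u \sum_(v | v != u) codegree H [set u; v] ^ 2)%:R.
Proof.
rewrite natr_sum [RHS](reindex (enum_val : 'I_#|V| -> V)) /=; last first.
  exact/onW_bij/enum_val_bij.
apply: eq_bigr => i _; rewrite -{1 2}(enum_valK i) adjmx_sqrE.
by congr _%:R; apply: eq_big => w; rewrite ?andbb // (setUC [set w]) mulnn.
Qed.

Lemma adjmx_sqr_scalar_matching (c : R) :
    A *m A = c%:M -> edges H != set0 ->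
  [/\ uniform H 2, trivIset (edges H) & forall v, ~ isolated H v].
Proof.
move=> AA edges_neq0.
have AAE u v : (c *+ (u == v) = (\sum_(w | (w != u) && (w != v))
      codegree H [set u; w] * codegree H [set w; v])%:R).
  by rewrite -adjmx_sqrE AA mxE (inj_eq enum_rank_inj).
(* A walk u, w, v contributes a positive product to the (u, v) entry. The case u = v is allowed, so
   this serves on and off the diagonal. *)
have walk2 u w v e f : e \in edges H -> f \in edges H -> w != u -> w != v ->
    u \in e -> w \in e -> w \in f -> v \in f -> c *+ (u == v) != 0.
  move=> eH fH wu wv ue we wf vf; rewrite AAE pnatr_eq0 -lt0n.
  rewrite (bigD1 w) ?wu //= ltn_addr // muln_gt0.
  by apply/andP; split; apply/codegree2_gt0; [exists e | exists f].
(* An off-diagonal entry of A^2 = c I vanishes, so every vertex has at most one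
   neighbour. *)
have nbr_uniq u w v e f : e \in edges H -> f \in edges H -> w != u -> w != v ->
    u \in e -> w \in e -> w \in f -> v \in f -> u = v.
  move=> eH fH wu wv ue we wf vf; apply/eqP; apply: contraT => /negPf uv.
  by have := walk2 _ _ _ _ _ eH fH wu wv ue we wf vf; rewrite uv mulr0n eqxx.
have c_neq0 : c != 0.
  have [e eH] := set0Pn _ edges_neq0.
  have /card_gt1P[x [y [xe ye xy]]] := edges_card_ge2 eH.
  by have := walk2 y x y e e eH eH xy xy ye xe xe ye; rewrite eqxx.
(* Besides w, the edge f has a vertex y. A vertex x of e other than w is a neighbour of w, as is y,
   so x = y lies in f. *)
have edge_sub e f w : e \in edges H -> f \in edges H -> w \in e -> w \in f ->
    e \subset f.
  move=> eH fH we wf; apply/subsetP => x xe; have [<- // | wx] := eqVneq w x.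
  have : (0 < #|f :\ w|)%N by have := edges_card_ge2 fH; rewrite (cardsD1 w) wf.
  case/card_gt0P=> y; rewrite !inE eq_sym => /andP[wy yf].
  by rewrite (nbr_uniq x w y e f).
split=> [e eH | | v v_isol].
- have /card_gt1P[x [y [xe ye xy]]] := edges_card_ge2 eH.
  suff -> : e = [set x; y] by rewrite cards2 xy.
  apply/eqP; rewrite eqEsubset subUset !sub1set xe ye !andbT.
  apply/subsetP => z ze; rewrite !inE; have [// | zx] := eqVneq z x.
  (* A further vertex z of e would be, like y, a neighbour of x. *)
  by apply/eqP; apply: (nbr_uniq z x y e e); rewrite // eq_sym.
- apply/trivIsetP => e f eH fH; apply: contraNT.
  case/pred0Pn=> w /= /andP[we wf].
  by rewrite eqEsubset (edge_sub e f w) // (edge_sub f e w).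
(* At an isolated vertex every term of the diagonal entry vanishes, contradicting [c_neq0]. *)
have := AAE v v; rewrite eqxx big1 ?mulr0n => [/eqP | w _].
  by rewrite (negPf c_neq0).
apply/eqP; rewrite muln_eq0 -leqn0 leqNgt; apply/orP; left.
by apply/negP => /codegree2_gt0[e [eH ve _]]; have := v_isol e eH; rewrite ve.
Qed.

End Adjacency.

(** * Perfect matchings *)

Section Matching.
Hypotheses (unif : uniform H 2) (triv : trivIset (edges H)).
Hypothesis noisol : forall v, ~ isolated H v.

Lemma matching_edge_eq (e f : {set V}) (v : V) :
  e \in edges H -> f \in edges H -> v \in e -> v \in f -> e = f.
Proof.
move=> eH fH ve vf; apply/eqP; apply: contraT => /(trivIsetP triv _ _ eH fH).
by case/pred0P/(_ v)/negP; rewrite /= ve.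
Qed.

Lemma matching_degree (v : V) : degree H v = 1%N.
Proof.
apply/eqP; rewrite eqn_leq; apply/andP; split.
  apply/card_le1_eqP => e f; rewrite !inE !sub1set => /andP[eH ve] /andP[fH vf].
  exact: (@matching_edge_eq _ _ v).
rewrite lt0n; apply/eqP => deg0; case: (noisol (v := v)) => e eH.
apply/negP => ve; have := card0_eq deg0 e.
by rewrite !inE eH sub1set ve.
Qed.

Lemma matching_card : #|V| = (2 * #|edges H|)%N.
Proof.
have := sum_degree; under eq_bigr do rewrite matching_degree.
rewrite sum1_card => ->; rewrite (eq_bigr (fun _ => 2%N)) => [|e /unif //].
by rewrite sum_nat_const mulnC.
Qed.

Lemma matching_adjmx_sqr (R : rcfType) : adjmx H R *m adjmx H R = 1%:M.
Proof.
apply/matrixP => i j; rewrite -(enum_valK i) -(enum_valK j).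
move: (enum_val i) (enum_val j) => u v {i j}.
rewrite adjmx_sqrE mxE (inj_eq enum_rank_inj); congr _%:R.
(* Off the diagonal, a common neighbour w would force both edges through w to coincide, giving an
   edge with three distinct vertices. *)
have [<-{v} | uv] := eqVneq u v; last first.
  apply: big1 => w /andP[wu wv]; apply/eqP; apply: contraT.
  rewrite -lt0n muln_gt0 => /andP[/codegree2_gt0[e [eH ue we]]].
  case/codegree2_gt0=> f [fH wf vf].
  rewrite -(matching_edge_eq eH fH we wf) in vf.
  suff : (3 <= #|e|)%N by rewrite (unif eH).
  have -> : 3%N = #|w |: [set u; v]|.
    by rewrite cardsU1 cards2 !inE negb_or wu wv uv.
  by apply: subset_leq_card; rewrite !subUset !sub1set we ue.
under eq_bigl do rewrite andbb.
(* Codegrees are at most the degree 1, so each equals its own square. *)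
transitivity (\sum_(w | w != u) codegree H [set u; w])%N.
  apply: eq_bigr => w _; rewrite (setUC [set w]).
  have : (codegree H [set u; w] <= degree H u)%N by rewrite codegreeS ?subsetUl.
  by rewrite matching_degree; case: codegree => [|[]].
rewrite sum_codegree2 (eq_bigr (fun=> 1%N)) => [|e /andP[/unif -> //]].
rewrite sum1_card -[RHS](matching_degree u); apply: eq_card => e.
by rewrite !inE sub1set.
Qed.

(** With rank at most 2 and maximum degree at most 1, the left side is at most n * m * 2, and n =
    2m. An inequality suffices for the final squeeze and also covers an empty vertex set, where the
    rank is 0. *)
Lemma matching_bound :
  (#|V| * #|edges H| * (rank H * (rank H).-1) * max_degree H <= #|V| * #|V|)%N.
Proof.
have r2 : (rank H <= 2)%N by apply/bigmax_leqP => e /unif ->.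
have D1 : (max_degree H <= 1)%N.
  by apply/bigmax_leqP => v _; rewrite matching_degree.
rewrite [X in (_ <= _ * X)%N]matching_card [(2 * _)%N]mulnC -!mulnA !leq_mul //.
by apply: leq_trans (leq_mul r2 (leq_mul (leq_sub2r 1 r2) D1)); rewrite subn1.
Qed.

End Matching.

End CodegreeBounds.

(** * From the spectrum to the energy *)

Section EnergyBounds.
Variables (R : rcfType) (V : finType) (H : hypergraph V).
Local Notation E := (energy H R).
Local Notation lam := (eigenvalues H R).
Local Notation T :=
  (\sum_u \sum_(v | v != u) codegree H [set u; v] ^ 2)%N.

Lemma energy_ge0 : 0 <= E.
Proof. exact: sumr_ge0. Qed.

Lemma energy_sqr_dev :
  \sum_i (#|V|%:R * `|tnth lam i| - E) ^+ 2
    = #|V|%:R * (#|V|%:R * T%:R - E ^+ 2) :> R.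
Proof.
have := sum_sqr_dev (fun i => `|tnth lam i|); rewrite card_ord => ->.
rewrite -tr_adjmx_sqr -(sum_sqr_spectrum (adjmx_sym H R) (eigenvaluesP H R)).
rewrite big_tuple; congr (_ * (_ * _ - _)).
by apply: eq_bigr => i _; rewrite real_normK ?num_real.
Qed.

Lemma energy_sqr_le : E ^+ 2 <= #|V|%:R * T%:R.
Proof.
have : 0 <= #|V|%:R * (#|V|%:R * T%:R - E ^+ 2) :> R.
  by rewrite -energy_sqr_dev sumr_ge0 // => i _; rewrite sqr_ge0.
(* The factor n of the deviation identity cancels only when positive; without vertices the energy is
   an empty sum. *)
have [n0 _ | n_gt0] := posnP #|V|; last first.
  by rewrite pmulr_rge0 ?ltr0n // subr_ge0.
rewrite /energy big1 ?expr0n ?mulr_ge0 // => i.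
by have := ltn_ord i; rewrite {2}n0.
Qed.

(** All deviations from the mean vanish, so each eigenvalue has absolute value E / n. *)
Lemma energy_sqr_eq_const : (0 < #|V|)%N -> E ^+ 2 = #|V|%:R * T%:R ->
  adjmx H R *m adjmx H R = ((E / #|V|%:R) ^+ 2)%:M.
Proof.
move=> n_gt0 eqE; have n_neq0 : #|V|%:R != 0 :> R by rewrite pnatr_eq0 -lt0n.
apply: (sqr_spectrum_const (adjmx_sym H R) (eigenvaluesP H R)).
move=> x /tnthP[i ->].
have /psumr_eq0P dev0 : \sum_i (#|V|%:R * `|tnth lam i| - E) ^+ 2 = 0.
  by rewrite energy_sqr_dev eqE subrr mulr0.
have /eqP := dev0 (fun i _ => sqr_ge0 _) i isT.
rewrite sqrf_eq0 subr_eq0 => /eqP <-.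
by rewrite mulrC mulKf // real_normK ?num_real.
Qed.

Lemma codegree_sqr_le_zagreb : (T <= (rank H).-1 * zagreb H)%N.
Proof.
rewrite /zagreb big_distrr; apply: leq_sum => u _.
exact: sum_codegree2_sqr_le.
Qed.

(** The squared adjacency matrix is the identity, so each of the n eigenvalues has absolute value
    1. *)
Lemma energy_matching : uniform H 2 -> trivIset (edges H) ->
  (forall v, ~ isolated H v) -> E = #|V|%:R.
Proof.
move=> unif triv noisol; rewrite -[in RHS](card_ord #|V|) -sumr_const.
apply: eq_bigr => i _; apply/eqP.
rewrite -(@eqrXn2 _ 2) // real_normK ?num_real // expr1n.
have AA := matching_adjmx_sqr unif triv noisol R.
rewrite (eigenvalue_sqr_scalar AA) //.
exact: (spectrum_eigenvalue (eigenvaluesP H R) (mem_tnth _ _)).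
Qed.

End EnergyBounds.

Theorem theorem21 (R : rcfType) (V : finType) (H : hypergraph V) :
  let n : R := #|V|%:R in
  let m : R := #|edges H|%:R in
  let r : R := (rank H)%:R in
  let Delta : R := (max_degree H)%:R in
  let Z : R := (zagreb H)%:R in
  let bound1 : R := Num.sqrt (n * (r - 1) * Z) in
  let bound2 : R := Num.sqrt (n * m * (r ^+ 2 - r) * Delta) in
  let extremal : Prop :=
    (uniform H 2 /\ trivIset (edges H) /\ (forall v : V, ~ isolated H v))
    \/ edges H = set0 in
  energy H R <= bound1 /\ bound1 <= bound2
  /\ (energy H R = bound1 <-> extremal)
  /\ (energy H R = bound2 <-> extremal).
Proof.
move=> n m r Delta Z bound1 bound2 extremal.
(* The radicands as natural numbers, so that they can be compared in [nat]. *)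
pose b1 := (#|V| * ((rank H).-1 * zagreb H))%N.
pose b2 := (#|V| * #|edges H| * (rank H * (rank H).-1) * max_degree H)%N.
have Zle := zagreb_le H.
(* At rank 0, where (rank H).-1 is not r - 1, the factor Z vanishes. *)
have bound1E : bound1 = Num.sqrt b1%:R.
  rewrite /bound1 /b1 /n /r /Z -mulrA !natrM; case: (rank H) Zle => [|k _].
    by rewrite muln0 leqn0 => /eqP ->; rewrite !mulr0.
  by rewrite -natr1 addrK.
have bound2E : bound2 = Num.sqrt b2%:R.
  rewrite /bound2 /b2 !natrM -/n -/m -/Delta -/r; congr (Num.sqrt (_ * _ * _)).
  by rewrite /r; case: (rank H) => [|k] /=; rewrite -?natr1; ring.
have b12 : (b1 <= b2)%N.
  rewrite /b1 /b2 -!mulnA leq_mul2l; apply/orP; right.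
  apply: leq_trans (leq_mul (leqnn _) Zle) _.
  by rewrite mulnC -!mulnA [(max_degree H * _)%N]mulnC.
have EE : energy H R = Num.sqrt (energy H R ^+ 2).
  by rewrite sqrtr_sqr ger0_norm ?energy_ge0.
have Tle := codegree_sqr_le_zagreb H.
have E1 : energy H R <= bound1.
  rewrite bound1E EE ler_wsqrtr //; apply: le_trans (energy_sqr_le R H) _.
  by rewrite -natrM ler_nat leq_mul.
have B12 : bound1 <= bound2 by rewrite bound1E bound2E ler_wsqrtr // ler_nat.
have eq_ext : energy H R = bound1 -> extremal.
  move=> eqE; have [e0 | edges_neq0] := eqVneq (edges H) set0; [by right | left].
  have V_gt0 : (0 < #|V|)%N.
    have [e eH] := set0Pn _ edges_neq0.
    exact: leq_trans (ltnW (edges_card_ge2 eH)) (max_card _).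
  have eqE2 : energy H R ^+ 2 = b1%:R by rewrite eqE bound1E sqr_sqrtr.
  have AA := energy_sqr_eq_const (R := R) (H := H) V_gt0.
  have [|? ? ?] // := adjmx_sqr_scalar_matching (AA _) edges_neq0.
  (* The quantity n T, with T the sum of squared codegrees, lies between the squared energy and
     [b1], which are equal here. *)
  apply/le_anti; rewrite energy_sqr_le eqE2 -natrM ler_nat leq_mul2l Tle.
  exact: orbT.
(* This closes the cycle E <= [bound1] <= [bound2] <= E, so one inequality settles both equality
   cases. *)
have ext_eq : extremal -> bound2 <= energy H R.
  case=> [[unif [triv noisol]] | edges0].
    rewrite bound2E (energy_matching R unif triv noisol).
    rewrite -[leRHS]ger0_norm // -sqrtr_sqr ler_wsqrtr // -natrX ler_nat -mulnn.
    exact: matching_bound.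
  rewrite bound2E /b2 edges0 cards0 muln0 !mul0n sqrtr0; exact: energy_ge0.
split=> //; split=> //; split; split=> [|ext].
- exact: eq_ext.
- by apply/le_anti; rewrite E1 (le_trans B12) ?ext_eq.
- by move=> eqE; apply: eq_ext; apply/le_anti; rewrite E1 eqE B12.
by apply/le_anti; rewrite (le_trans E1 B12) ext_eq.
Qed.
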